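(* Let $(X,b,m)$ be a weighted graph satisfying (C), (B), (M), let $D\subseteq X$, $T>0$, $r\in[1,\infty)$, $K\ge0$, $\alpha\in[0,e^{-D_{\max}T})$, and assume the linear control problem $(H,D)$ is $(\alpha,T,r,K)$-controllable. Then $D$ is $d_{\mathrm{comb}}$-relatively dense.
   Context: Weighted graph $(X,b,m)$: $X$ countable, $m\colon X\to(0,\infty)$, $b\colon X\times X\to[0,\infty)$ symmetric, $b(x,x)=0$, $\sum_yb(x,y)<\infty$. Paths are sequences $(x_0,\dots,x_k)$ with $b(x_j,x_{j+1})>0$. (C) connected; (B) $D_{\max}:=\sup_x\operatorname{Deg}(x)<\infty$, $\operatorname{Deg}(x)=\frac1{m(x)}\sum_yb(x,y)$; (M) $\sup_xm(x)<\infty$. Combinatorial metric $d_{\mathrm{comb}}(x,y)$: minimal $n$ such that a path $(x_0,\dots,x_n)$ from $x$ to $y$ exists ($0$ if $x=y$). $D$ is $d_{\mathrm{comb}}$-relatively dense if $\inf\{R>0:\bigcup_{x\in D}\{y:d_{\mathrm{comb}}(x,y)\le R\}=X\}<\infty$. $H$ is the weighted Laplacian $Hf(x)=\frac1{m(x)}\sum_yb(x,y)(f(x)-f(y))$ on $\ell_2(X,m)$, $S_t=e^{-tH}$. The control problem $(H,D)$: $\dot f=-Hf+\mathbf 1_Du$, $f(0)=f_0$, $\mathbf 1_D$ extension by zero, mild solution $f(t)=S_tf_0+\int_0^tS_{t-\tau}\mathbf 1_Du(\tau)d\tau$; $(\alpha,T,r,K)$-controllable means for all $f_0\in\ell_2(X,m)$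 there is $u\in L_r((0,T);\ell_2(D,m|_D))$ with $\|u\|_{L_r}\le K\|f_0\|$ and $\|f(T)\|\le\alpha\|f_0\|$. *)

(* Defs.v *)
From HB Require Import structures.
From mathcomp Require Import all_boot all_order all_algebra.
From mathcomp Require Import all_classical all_reals all_analysis.
Set Implicit Arguments. Unset Strict Implicit. Unset Printing Implicit Defensive.
Import Order.TTheory GRing.Theory Num.Theory numFieldNormedType.Exports.
Local Open Scope classical_set_scope.
Local Open Scope ring_scope.

Section Graph.
Variables (R : realType) (X : countType).
Variables (b : X -> X -> R) (m : X -> R).

Definition weighted_graph : Prop :=
  [/\ forall x, 0 < m x,
      forall x y, 0 <= b x y,
      forall x y, b x y = b y x,
      forall x, b x x = 0
    & forall x, (\esum_(y in [set: X]) (b x y)%:E < +oo)%E].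

(* sum of an (absolutely summable) real family over X:
   positive part minus negative part *)
Definition xsum (g : X -> R) : R :=
  fine (\esum_(y in [set: X]) (Num.max (g y) 0)%:E)
  - fine (\esum_(y in [set: X]) (Num.max (- g y) 0)%:E).

Definition Deg (x : X) : R := (m x)^-1 * fine (\esum_(y in [set: X]) (b x y)%:E).

Definition Dmax : R := sup (range Deg).

Definition is_path_len (x y : X) (n : nat) : Prop :=
  exists p : nat -> X, [/\ p 0%N = x, p n = y
                        & forall j, (j < n)%N -> 0 < b (p j) (p j.+1)].

Definition connected_graph : Prop := forall x y, exists n, is_path_len x y n.
Definition bounded_deg : Prop := exists M : R, forall x, Deg x <= M.
Definition bounded_meas : Prop := exists M : R, forall x, m x <= M.

Definition dcomb_le (x y : X) (n : nat) : Prop :=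
  exists k, (k <= n)%N /\ is_path_len x y k.

(* D is d_comb-relatively dense: inf{R>0 : union of balls B_R(x), x in D, = X} < oo,
   i.e. this set of radii is nonempty *)
Definition dcomb_rel_dense (D : set X) : Prop :=
  exists Rad : R, 0 < Rad /\
    forall y, exists x, D x /\ exists n : nat, n%:R <= Rad /\ dcomb_le x y n.

Definition I0t (t : R) : set R := `[0, t]%classic.

Definition sqnorm (A : set X) (f : X -> R) : \bar R :=
  \esum_(x in A) (f x ^+ 2 * m x)%:E.

Definition in_l2 (f : X -> R) : Prop := (sqnorm [set: X] f < +oo)%E.

Definition Lap (f : X -> R) : X -> R :=
  fun x => (m x)^-1 * xsum (fun y => b x y * (f x - f y)).

(* S_t = e^{-tH} = sum_k (-t)^k H^k / k!  (H is bounded under (B));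
   the series converges in l2, hence pointwise *)
Definition Sg (t : R) (f : X -> R) : X -> R :=
  fun x => limn (series ((fun k : nat => (- t) ^+ k / (k`!)%:R * iter k Lap f x) : R^nat)).

Definition ext0 (D : set X) (v : X -> R) : X -> R :=
  fun x => if `[< D x >] then v x else 0.

(* mild solution at time t, the integral of the l2-valued map is taken
   coordinatewise (evaluation at x is a continuous linear functional) *)
Definition mild_sol (D : set X) (f0 : X -> R) (u : R -> X -> R) (t : R) : X -> R :=
  fun x => Sg t f0 x +
    fine (\int[lebesgue_measure]_(s in I0t t) (Sg (t - s) (ext0 D (u s)) x)%:E)%E.

(* u in L_r((0,T); l2(D, m|_D)) with ||u||_{L_r} <= Kb.  A representative with
   u(s) in l2(D) for every s is chosen (modification on a null set);
   strong measurability = coordinatewise measurability (l2(D) separable, Pettis) *)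
Definition Lr_control (D : set X) (T r Kb : R) (u : R -> X -> R) : Prop :=
  [/\ forall x, D x -> measurable_fun (I0t T) (fun s => u s x),
      forall s, I0t T s -> (sqnorm D (u s) < +oo)%E,
      (\int[lebesgue_measure]_(s in I0t T)
          ((Num.sqrt (fine (sqnorm D (u s)))) `^ r)%:E < +oo)%E
    & (fine (\int[lebesgue_measure]_(s in I0t T)
          ((Num.sqrt (fine (sqnorm D (u s)))) `^ r)%:E)) `^ r^-1 <= Kb].

Definition controllable (D : set X) (alpha T r K : R) : Prop :=
  forall f0 : X -> R, in_l2 f0 ->
    exists u : R -> X -> R,
      Lr_control D T r (K * Num.sqrt (fine (sqnorm [set: X] f0))) u /\
      (sqnorm [set: X] (mild_sol D f0 u T)
         <= ((alpha * Num.sqrt (fine (sqnorm [set: X] f0))) ^+ 2)%:E)%E.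

End Graph.

(* Main.v *)
Require Import Defs.
From HB Require Import structures.
From mathcomp Require Import all_boot all_order all_algebra.
From mathcomp Require Import all_classical all_reals all_analysis.
From mathcomp Require Import measurable_realfun ring lra.
Set Implicit Arguments. Unset Strict Implicit. Unset Printing Implicit Defensive.
Import Order.TTheory GRing.Theory Num.Theory numFieldNormedType.Exports.
Local Open Scope classical_set_scope.
Local Open Scope ring_scope.

(* If D is not relatively dense, there are vertices y arbitrarily far from D;
   start the system at f0 = 1_y / sqrt (m y), a unit vector.  Writing
   H = Dmax - P with P positivity preserving gives
   S_T f0 y >= e^(-Dmax T) f0 y.  On the other hand H only sees neighbours, so
   for w supported at distance more than n from y the first n + 1 terms of the
   exponential series of S_t w vanish at y, and ||H|| <= 2 Dmax bounds
   sqrt (m y) |S_t w y| by ||w|| times the tail of the series of e^(2 Dmax T).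
   Hence the control changes sqrt (m y) f(T) y by an amount that tends to 0 as
   n grows, and alpha >= sqrt (m y) |f(T) y| >= e^(-Dmax T) - o(1). *)

(** * Unordered sums of nonnegative families, with real values *)

Section ExtendedSums.
Variables (R : realType) (T : choiceType).
Implicit Types (I : set T) (g h : T -> R).

Lemma ge0_esumZl I (c : R) (a : T -> \bar R) :
  0 <= c -> (forall i, 0 <= a i)%E ->
  (\esum_(i in I) (c%:E * a i) = c%:E * \esum_(i in I) a i)%E.
Proof.
move=> c0 a0; rewrite /esum -ereal_supZl//; last first.
  by apply/set0P; eexists; exists set0; [exact: fsets_set0|reflexivity].
rewrite image_comp; congr ereal_sup; apply: eq_imagel => A _ /=.
by rewrite ge0_mule_fsumr.
Qed.

Lemma esum_ge1 I (a : T -> \bar R) x :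
  I x -> (forall i, 0 <= a i)%E -> (a x <= \esum_(i in I) a i)%E.
Proof.
move=> Ix a0; apply: esum_ge; exists [set x]; last by rewrite fsbig_set1.
by split; [exact: finite_set1|move=> _ ->].
Qed.

(** [esum] is a supremum of finite partial sums and [fine] sends an infinite value to 0, so this is
    the genuine sum only for nonnegative [g] with [rsummable g]. *)
Definition rsum g : R := fine (\esum_(i in [set: T]) (g i)%:E)%E.

Definition rsummable g := (\esum_(i in [set: T]) `|g i|%:E < +oo)%E.

Lemma esum_rsum g : (forall i, 0 <= g i) -> rsummable g ->
  (\esum_(i in [set: T]) (g i)%:E = (rsum g)%:E)%E.
Proof.
move=> g0; rewrite /rsummable /rsum => gs.
rewrite fineK// ge0_fin_numE; last by apply: esum_ge0 => i _; rewrite lee_fin.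
by apply: le_lt_trans gs; apply: le_esum => i _; rewrite ger0_norm.
Qed.

Lemma le_rsummable g h : (forall i, `|g i| <= `|h i|) ->
  rsummable h -> rsummable g.
Proof. by move=> gh; apply: le_lt_trans; apply: le_esum => i _; rewrite lee_fin. Qed.

Lemma rsummableD g h : rsummable g -> rsummable h ->
  rsummable (fun i => g i + h i).
Proof.
move=> gs hs; apply: le_lt_trans (lte_add_pinfty gs hs).
rewrite -esumD//; apply: le_esum => i _.
by rewrite -EFinD lee_fin ler_normD.
Qed.

Lemma rsummableZ (c : R) g : rsummable g -> rsummable (fun i => c * g i).
Proof.
move=> gs; rewrite /rsummable.
under eq_esum do rewrite normrM EFinM.
by rewrite ge0_esumZl// lte_mul_pinfty.
Qed.

Lemma rsumD g h : (forall i, 0 <= g i) -> (forall i, 0 <= h i) ->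
  rsummable g -> rsummable h ->
  rsum (fun i => g i + h i) = rsum g + rsum h.
Proof.
move=> g0 h0 gs hs; apply: (@EFin_inj R).
rewrite -esum_rsum//; last exact: rsummableD.
  by rewrite EFinD -!esum_rsum// -esumD// => i _; rewrite lee_fin.
by move=> i; rewrite addr_ge0.
Qed.

Lemma rsumZ (c : R) g : 0 <= c -> (forall i, 0 <= g i) -> rsummable g ->
  rsum (fun i => c * g i) = c * rsum g.
Proof.
move=> c0 g0 gs; apply: (@EFin_inj R); rewrite -esum_rsum; first last.
- exact: rsummableZ.
- by move=> i; rewrite mulr_ge0.
- by rewrite EFinM -esum_rsum// -ge0_esumZl// => i; rewrite lee_fin.
Qed.

Lemma rsum_ge0 g : (forall i, 0 <= g i) -> 0 <= rsum g.
Proof. by move=> g0; rewrite fine_ge0// esum_ge0// => i _; rewrite lee_fin. Qed.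

Lemma le_rsum g h : (forall i, 0 <= g i) -> (forall i, g i <= h i) ->
  rsummable h -> rsum g <= rsum h.
Proof.
move=> g0 gh hs.
have h0 i : 0 <= h i by exact: le_trans (gh i).
rewrite -lee_fin -!esum_rsum//.
- by apply: le_esum => i _; rewrite lee_fin.
- by apply: le_rsummable hs => i; rewrite !ger0_norm.
Qed.

End ExtendedSums.

(** * Linearity of the signed sum [xsum] *)

Section SignedSums.
Variables (R : realType) (X : countType).
Implicit Types g h p q : X -> R.

Lemma xsumE g : xsum g = rsum (fun y => Num.max (g y) 0) -
  rsum (fun y => Num.max (- g y) 0).
Proof. by []. Qed.

Lemma rsummable_pos g : rsummable g -> rsummable (fun y => Num.max (g y) 0).
Proof.
apply: le_rsummable => y; rewrite ger0_norm ?le_max ?lexx ?orbT//.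
by rewrite ge_max ler_norm normr_ge0.
Qed.

Lemma rsummableN g : rsummable g -> rsummable (fun y => - g y).
Proof. by apply: le_rsummable => y; rewrite normrN. Qed.

(** [xsum] is defined by the positive and negative parts; any other splitting into summable
    nonnegative families may replace them. Moving the subtracted sums across leaves an identity
    between nonnegative sums that holds termwise. *)
Lemma xsumB p q : (forall y, 0 <= p y) -> (forall y, 0 <= q y) ->
  rsummable p -> rsummable q ->
  xsum (fun y => p y - q y) = rsum p - rsum q.
Proof.
move=> p0 q0 ps qs.
have s : rsummable (fun y => p y - q y).
  by apply: rsummableD => //; exact: rsummableN.
have m0 (a : R) : 0 <= Num.max a 0 by rewrite le_max lexx orbT.
rewrite xsumE; apply/eqP; rewrite subr_eq addrAC eq_sym subr_eq; apply/eqP.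
rewrite -!rsumD//; try exact: rsummable_pos.
  congr rsum; apply/funext => y.
  by rewrite opprB; case: (leP (p y - q y) 0); case: (leP (q y - p y) 0); lra.
have := rsummable_pos (rsummableN s).
by congr rsummable; apply/funext.
Qed.

Lemma pos_negE (a : R) : a = Num.max a 0 - Num.max (- a) 0.
Proof. by case: (leP a 0); case: (leP (- a) 0); lra. Qed.

Lemma norm_pos_negE (a : R) : `|a| = Num.max a 0 + Num.max (- a) 0.
Proof.
have [a0|a0] := leP 0 a; [rewrite ger0_norm//|rewrite ltr0_norm//];
by case: (leP a 0); case: (leP (- a) 0); lra.
Qed.

Lemma xsumN g : xsum (fun y => - g y) = - xsum g.
Proof.
rewrite !xsumE opprB; congr (_ - rsum _).
by apply/funext => y; rewrite opprK.
Qed.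

Lemma xsumD g h : rsummable g -> rsummable h ->
  xsum (fun y => g y + h y) = xsum g + xsum h.
Proof.
move=> gs hs.
have m0 (a : R) : 0 <= Num.max a 0 by rewrite le_max lexx orbT.
have -> : (fun y => g y + h y) = (fun y => (Num.max (g y) 0 + Num.max (h y) 0)
    - (Num.max (- g y) 0 + Num.max (- h y) 0)).
  by apply/funext => y; rewrite {1}(pos_negE (g y)) {1}(pos_negE (h y)); ring.
have [gp hp] := (rsummable_pos gs, rsummable_pos hs).
have [gn hn] := (rsummable_pos (rsummableN gs), rsummable_pos (rsummableN hs)).
rewrite xsumB; last 4 first.
- by move=> y; rewrite addr_ge0.
- by move=> y; rewrite addr_ge0.
- exact: rsummableD.
- exact: rsummableD.
by rewrite !rsumD// !xsumE; ring.
Qed.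

Lemma xsumZ (c : R) g : rsummable g -> xsum (fun y => c * g y) = c * xsum g.
Proof.
have m0 (a : R) : 0 <= Num.max a 0 by rewrite le_max lexx orbT.
(* Positive parts scale only by nonnegative factors; a negative [c] is reduced to [- c] by
   [xsumN]. *)
wlog c0 : c / 0 <= c => [hw gs|gs].
  have [c0|c0] := leP 0 c; first exact: hw.
  rewrite -[c in RHS]opprK mulNr -hw ?oppr_ge0 1?ltW// -xsumN.
  by congr xsum; apply/funext => y; rewrite mulNr opprK.
have -> : (fun y => c * g y) = (fun y => c * Num.max (g y) 0 - c * Num.max (- g y) 0).
  by apply/funext => y; rewrite {1}(pos_negE (g y)); ring.
have [gp gn] := (rsummable_pos gs, rsummable_pos (rsummableN gs)).
rewrite xsumB; last 4 first.
- by move=> y; rewrite mulr_ge0.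
- by move=> y; rewrite mulr_ge0.
- exact: rsummableZ.
- exact: rsummableZ.
by rewrite !rsumZ// !xsumE; ring.
Qed.

Lemma ler_norm_xsum g : rsummable g -> `|xsum g| <= rsum (fun y => `|g y|).
Proof.
move=> gs; rewrite xsumE.
have m0 (a : R) : 0 <= Num.max a 0 by rewrite le_max lexx orbT.
have [gp gn] := (rsummable_pos gs, rsummable_pos (rsummableN gs)).
have -> : (fun y => `|g y|) = (fun y => Num.max (g y) 0 + Num.max (- g y) 0).
  by apply/funext => y; rewrite norm_pos_negE.
rewrite rsumD//.
have := rsum_ge0 (fun y => m0 (g y)); have := rsum_ge0 (fun y => m0 (- g y)).
by move=> ? ?; rewrite ler_norml; apply/andP; split; lra.
Qed.

Lemma xsum0 : xsum (fun _ : X => 0 : R) = 0.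
Proof. by have := xsumN (fun _ : X => 0 : R); rewrite oppr0; lra. Qed.

End SignedSums.

(** Tonelli: each iterated sum is a sum over pairs, and transposition of pairs matches the two. *)
Lemma esum_swap (R : realType) (T : choiceType) (a : T -> T -> \bar R) : (forall x y, 0 <= a x y)%E ->
  (\esum_(x in [set: T]) \esum_(y in [set: T]) a x y =
   \esum_(y in [set: T]) \esum_(x in [set: T]) a x y)%E.
Proof.
move=> a0; rewrite (@esum_esum _ _ _ _ (fun=> setT))//.
rewrite (@esum_esum _ _ _ _ (fun=> setT) (fun y x => a x y))//.
rewrite (reindex_esum ([set: T] `*`` (fun=> [set: T])) _ (fun z => (z.2, z.1)))//.
split => //.
- by move=> [x1 y1] [x2 y2] /= _ _ [-> ->].
- by move=> [x y] /= _; exists (y, x).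
Qed.

(** * Cauchy products, tails of the exponential series, binomial expansion *)

Section ExponentialSeries.
Variable R : realType.
Implicit Types (u v : R^nat) (A B C : R).

Definition cauchy_prod u v : R^nat :=
  fun k => \sum_(i < k.+1) u i * v (k - i)%N.

(** The terms involved are those with i + j < n; they are grouped by i. *)
Lemma series_cauchy_prod u v n :
  series (cauchy_prod u v) n = \sum_(i < n) u i * series v (n - i)%N.
Proof.
elim: n => [|n IHn]; first by rewrite big_ord0 /series /= big_geq.
rewrite seriesSr IHn /cauchy_prod !big_ord_recr /= subSnn subnn.
rewrite addrA -big_split /=; congr (_ + _ * _).
  by apply: eq_bigr => i _; rewrite subSn 1?ltnW// seriesSr mulrDr.
by rewrite /series /= big_nat1.
Qed.

(** The defect is the sum of the products over i, j < n with i + j >= n, so it is dominated term by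
    term by the defect of the majorants. *)
Lemma cauchy_prod_defect u v u' v' n :
  (forall i, `|u i| <= u' i) -> (forall i, `|v i| <= v' i) ->
  `|series u n * series v n - series (cauchy_prod u v) n| <=
  series u' n * series v' n - series (cauchy_prod u' v') n.
Proof.
move=> uu' vv'.
have defectE (a b : R^nat) :
    series a n * series b n - series (cauchy_prod a b) n =
    \sum_(i < n) a i * \sum_(n - i <= j < n) b j.
  rewrite series_cauchy_prod {1}/series /= big_mkord mulr_suml -sumrB.
  apply: eq_bigr => i _; rewrite -mulrBr sub_series_geq//; exact: leq_subr.
rewrite !defectE; apply: le_trans (ler_norm_sum _ _ _) _; apply: ler_sum => i _.
rewrite normrM ler_pM//; apply: le_trans (ler_norm_sum _ _ _) _.
exact: ler_sum.
Qed.

Lemma cauchy_prod_exp_coeff A B :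
  cauchy_prod (exp_coeff A) (exp_coeff B) = exp_coeff (A + B).
Proof.
apply/funext => k; rewrite /cauchy_prod /exp_coeff /= addrC exprDn mulr_suml.
apply: eq_bigr => i _; rewrite -mulr_natr.
have ik : (i <= k)%N by rewrite -ltnS.
rewrite -(bin_fact ik) !natrM.
have f0 j : (j`!)%:R != 0 :> R by rewrite pnatr_eq0 -lt0n fact_gt0.
have c0 : 'C(k, i)%:R != 0 :> R by rewrite pnatr_eq0 -lt0n bin_gt0.
by field; rewrite !f0 c0.
Qed.

(** This domination gives absolute convergence, and the Cauchy product of the majorant with an
    exponential series is again explicit. *)
Definition exp_bounded u := exists C A, [/\ 0 <= C, 0 <= A &
  forall i, `|u i| <= C * exp_coeff A i].

Lemma is_cvg_series_exp_major C A : cvgn (series (fun i => C * exp_coeff A i)).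
Proof. exact/is_cvg_seriesZ/is_cvg_series_exp_coeff. Qed.

Lemma exp_bounded_normed u : exp_bounded u -> cvgn [normed series u].
Proof.
move=> [C [A [C0 A0 uCA]]]; have major_cvg := @is_cvg_series_exp_major C A.
apply: series_le_cvg major_cvg => //= n.
by rewrite mulr_ge0// exp_coeff_ge0.
Qed.

Lemma exp_bounded_cvg u : exp_bounded u -> cvgn (series u).
Proof. by move/exp_bounded_normed/normed_cvg. Qed.

(** By [cauchy_prod_defect] it suffices that the defect of the majorants vanishes in the limit, and
    there both the product and the Cauchy product tend to C e^(A + |B|). *)
Lemma cvg_cauchy_prod_exp u B : exp_bounded u ->
  series (cauchy_prod u (exp_coeff B)) n @[n --> \oo] -->
  limn (series u) * expR B.
Proof.
move=> ub; have [C [A [C0 A0 uCA]]] := ub.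
have vB i : `|exp_coeff B i| <= exp_coeff `|B| i.
  by rewrite /exp_coeff /= normrM normrX normfV normr_nat.
have prod_cvg : series u n * series (exp_coeff B) n @[n --> \oo] -->
    limn (series u) * expR B.
  by apply: cvgM; [exact: exp_bounded_cvg|exact: is_cvg_series_exp_coeff].
have major_cvg : series (fun i => C * exp_coeff A i) n * series (exp_coeff `|B|) n
    - series (cauchy_prod (fun i => C * exp_coeff A i) (exp_coeff `|B|)) n
    @[n --> \oo] --> (0 : R).
  have -> : cauchy_prod (fun i => C * exp_coeff A i) (exp_coeff `|B|) =
      fun i => C * exp_coeff (A + `|B|) i.
    rewrite -cauchy_prod_exp_coeff; apply/funext => k.
    by rewrite /cauchy_prod mulr_sumr; apply: eq_bigr => i _; rewrite mulrA.
  have cC D : series (fun i => C * exp_coeff D i) n @[n --> \oo] --> C * expR D.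
    have -> : series (fun i => C * exp_coeff D i) = (fun n => C * series (exp_coeff D) n).
      by apply/funext => n; rewrite /series /= mulr_sumr.
    by apply: cvgMr; exact: is_cvg_series_exp_coeff.
  rewrite -[X in _ --> X](subrr (C * expR (A + `|B|))).
  apply: cvgB; last exact: cC.
  by rewrite expRD mulrA; apply: cvgM; [exact: cC|exact: is_cvg_series_exp_coeff].
have defect_cvg : series u n * series (exp_coeff B) n
    - series (cauchy_prod u (exp_coeff B)) n @[n --> \oo] --> (0 : R).
  apply/norm_cvg0P; apply: (squeeze_cvgr _ (cvg_cst 0) major_cvg).
  by apply: nearW => n; rewrite normr_ge0 /=; exact: cauchy_prod_defect.
have diff_cvg := cvgB prod_cvg defect_cvg; rewrite subr0 in diff_cvg.
set W := series (cauchy_prod _ _); rewrite [W](_ : _ =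
    (fun n => series u n * series (exp_coeff B) n) \-
    (fun n => series u n * series (exp_coeff B) n - W n)); first exact: diff_cvg.
by apply/funext => n /=; rewrite opprB addrC subrK.
Qed.

Definition exp_tail A n := expR A - series (exp_coeff A) n.

Lemma cvg_exp_tail A : exp_tail A n @[n --> \oo] --> (0 : R).
Proof.
rewrite -[X in _ --> X](subrr (expR A)); apply: cvgB; first exact: cvg_cst.
exact: is_cvg_series_exp_coeff.
Qed.

Lemma exp_tail_ge0 A n : 0 <= A -> 0 <= exp_tail A n.
Proof.
move=> A0; rewrite subr_ge0; apply: nondecreasing_cvgn_le.
  by apply: nondecreasing_series => i _ _; exact: exp_coeff_ge0.
exact: is_cvg_series_exp_coeff.
Qed.

Lemma norm_lim_series_tail u C A n : 0 <= C -> 0 <= A ->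
  (forall i, `|u i| <= C * exp_coeff A i) -> (forall i, (i < n)%N -> u i = 0) ->
  `|limn (series u)| <= C * exp_tail A n.
Proof.
move=> C0 A0 uCA u0.
have ub : exp_bounded u by exists C, A; split.
apply: le_trans (lim_series_norm (exp_bounded_normed ub)) _.
have tail_cvg : C * (series (exp_coeff A) k - series (exp_coeff A) n) @[k --> \oo]
    --> C * exp_tail A n.
  apply: cvgMr; apply: cvgB; last exact: cvg_cst.
  exact: is_cvg_series_exp_coeff.
rewrite -(cvg_lim _ tail_cvg)//.
have le_tail k : (n <= k)%N -> series (fun i => `|u i|) k <=
    C * (series (exp_coeff A) k - series (exp_coeff A) n).
  move=> nk; rewrite sub_series_geq// mulr_sumr /series /= (big_cat_nat (n := n))//=.
  rewrite big_nat big1 ?add0r; first exact: ler_sum.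
  by move=> i /andP[_ /u0 ->]; rewrite normr0.
apply: ler_lim; [exact: exp_bounded_normed|by apply/cvg_ex; eexists; exact: tail_cvg|].
by near=> k; apply: le_tail; near: k; exists n.
Unshelve. all: by end_near. Qed.

(** The array stands for a k j = (H^k P^j f)(x) with H = D - P, and the conclusion is the binomial
    expansion of (D - P)^k, obtained on scalars without any algebra of operators. *)
Lemma binomial_recurrence (D : R) (a : nat -> nat -> R) :
  (forall k j, a k.+1 j = D * a k j - a k j.+1) ->
  forall k j, a k j =
    \sum_(i < k.+1) 'C(k, i)%:R * D ^+ (k - i) * (-1) ^+ i * a 0%N (i + j)%N.
Proof.
move=> rec; elim=> [|k IHk] j.
  by rewrite big_ord_recl big_ord0 bin0 subnn !expr0 !mul1r addr0.
rewrite rec !IHk mulr_sumr.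
rewrite [RHS]big_ord_recl [X in X - _]big_ord_recl /=.
(* Pascal's rule splits every summand but the first; the last term of the first half carries 'C(k,
   k+1) = 0. *)
rewrite [in RHS](eq_bigr (fun i : 'I_k.+1 =>
    'C(k, i.+1)%:R * D ^+ (k - i) * (-1) ^+ i.+1 * a 0%N (i.+1 + j)%N
  + 'C(k, i)%:R * D ^+ (k - i) * (-1) ^+ i.+1 * a 0%N (i.+1 + j)%N)); last first.
  by move=> i _; rewrite /bump /= add1n subSS binS natrD; ring.
rewrite big_split /= [X in _ = _ + (X + _)]big_ord_recr /= (@bin_small k k.+1)// !mul0r addr0.
rewrite addrA; congr (_ + _ + _).
- by rewrite !bin0 !subn0 exprS; ring.
- apply: eq_bigr => i _; rewrite /bump /= add1n.
  by rewrite -(subnSK (ltn_ord i)) [D ^+ _.+1]exprS; ring.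
- rewrite -sumrN; apply: eq_bigr => i _; rewrite addnS addSn [_ ^+ i.+1]exprS; ring.
Qed.

End ExponentialSeries.

(** * Positivity and the pointwise lower bound for the semigroup *)

Section SemigroupLowerBound.
Variables (R : realType) (X : countType) (b : X -> X -> R) (m : X -> R).
Hypothesis graph_bm : weighted_graph b m.
Variable M : R.
Hypothesis DegM : forall x, Deg b m x <= M.
Implicit Types (f g : X -> R) (x y : X).

Let m_gt0 x : 0 < m x. Proof. by case: graph_bm. Qed.
Let b_ge0 x y : 0 <= b x y. Proof. by case: graph_bm. Qed.

Lemma rsummable_edges x : rsummable (b x).
Proof.
case: graph_bm => _ _ _ _ /(_ x); apply: le_lt_trans; apply: le_esum => y _.
by rewrite ger0_norm.
Qed.

Lemma rsum_edges_le x : rsum (b x) <= M * m x.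
Proof. by have := DegM x; rewrite /Deg mulrC ler_pdivrMr. Qed.

Lemma Deg_bound_ge0 x : 0 <= M.
Proof.
apply: le_trans (DegM x); apply: mulr_ge0; [by rewrite invr_ge0 ltW|exact: (@rsum_ge0 _ _ (b x))].
Qed.

Lemma rsummable_grad (B : R) f x : (forall y, `|f y| <= B) ->
  rsummable (fun y => b x y * (f x - f y)).
Proof.
move=> fB; have s := rsummableZ (2 * B) (rsummable_edges x).
apply: le_rsummable s => y; rewrite !normrM (ger0_norm (b_ge0 x y)) mulrC.
apply: ler_wpM2r => //; rewrite -normrM.
apply: le_trans (ler_normB _ _) _; apply: le_trans (ler_norm _).
by have := fB x; have := fB y; lra.
Qed.

(** Differences of [f] are at most 2 B and the edge weights at [x] sum to at most [M * m x].
    Sup-norm bounds of this kind justify all series manipulations in this section. *)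
Lemma norm_Lap_bounded (B : R) f : (forall y, `|f y| <= B) ->
  forall x, `|Lap b m f x| <= 2 * M * B.
Proof.
move=> fB x; rewrite /Lap normrM gtr0_norm ?invr_gt0// mulrC ler_pdivrMr//.
apply: le_trans (ler_norm_xsum (rsummable_grad x fB)) _.
have B0 : 0 <= B by exact: le_trans (fB x).
apply: (@le_trans _ _ (rsum (fun y => 2 * B * b x y))).
  apply: le_rsum => //; last exact/rsummableZ/rsummable_edges.
  move=> y; rewrite normrM (ger0_norm (b_ge0 x y)) mulrC ler_wpM2r//.
  by apply: le_trans (ler_normB _ _) _; have := fB x; have := fB y; lra.
rewrite rsumZ ?mulr_ge0//; last exact: rsummable_edges.
by have := ler_wpM2l B0 (rsum_edges_le x); lra.
Qed.

Lemma LapB (c B C : R) f g :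
  (forall y, `|f y| <= B) -> (forall y, `|g y| <= C) ->
  Lap b m (fun y => c * f y - g y) = fun y => c * Lap b m f y - Lap b m g y.
Proof.
move=> fB gC; apply/funext => x; rewrite /Lap.
have gs := rsummable_grad x gC.
rewrite mulrCA -mulrBr; congr (_ * _).
rewrite -xsumZ; last exact: rsummable_grad fB.
rewrite -xsumN -xsumD; first by congr xsum; apply/funext => y; ring.
  exact/rsummableZ/(rsummable_grad x fB).
exact: rsummableN.
Qed.

(* The operator [P = M - H] is positivity preserving, which is what makes
   [e^(-tH) = e^(-tM) e^(tP) >= e^(-tM)] entrywise. *)
Definition shift_Lap f : X -> R := fun x => M * f x - Lap b m f x.

Lemma norm_shift_Lap (B : R) f : (forall y, `|f y| <= B) ->
  forall x, `|shift_Lap f x| <= B * (3 * M).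
Proof.
move=> fB x; apply: le_trans (ler_normB _ _) _.
have M0 := Deg_bound_ge0 x.
rewrite normrM (ger0_norm M0).
by have := norm_Lap_bounded fB x; have := ler_wpM2l M0 (fB x); lra.
Qed.

(** At [x] the value is (M - Deg x) f(x) plus the sum of b(x,y) f(y) divided by m(x), and both terms
    are nonnegative. *)
Lemma shift_Lap_ge0 (B : R) f : (forall y, `|f y| <= B) -> (forall y, 0 <= f y) ->
  forall x, 0 <= shift_Lap f x.
Proof.
move=> fB f0 x; rewrite subr_ge0; apply: (@le_trans _ _ (Deg b m x * f x)); last first.
  exact: ler_wpM2r.
rewrite /Lap /Deg -mulrA ler_wpM2l ?invr_ge0 ?(ltW (m_gt0 x))//.
have fs : rsummable (fun y => b x y * f y).
  apply: le_rsummable (rsummableZ B (rsummable_edges x)) => y.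
  rewrite !normrM mulrC ler_wpM2r//; exact: le_trans (fB y) (ler_norm _).
have -> : (fun y => b x y * (f x - f y)) = (fun y => f x * b x y - b x y * f y).
  by apply/funext => y; ring.
rewrite xsumB; last 4 first.
- by move=> y; rewrite mulr_ge0.
- by move=> y; rewrite mulr_ge0.
- exact/rsummableZ/rsummable_edges.
- exact: fs.
rewrite rsumZ//; last exact: rsummable_edges.
have : 0 <= rsum (fun y => b x y * f y) by apply: rsum_ge0 => y; rewrite mulr_ge0.
rewrite -/(rsum (b x)). lra.
Qed.

Lemma iter_Lap_bounded (B : R) f k : (forall y, `|f y| <= B) ->
  forall x, `|iter k (Lap b m) f x| <= (2 * M) ^+ k * B.
Proof.
elim: k => [|k IHk] fB x; first by rewrite expr0 mul1r.
rewrite iterS exprS -mulrA; apply: norm_Lap_bounded; exact: IHk.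
Qed.

Lemma iter_shift_Lap_bounded (B : R) f k : (forall y, `|f y| <= B) ->
  forall x, `|iter k shift_Lap f x| <= B * (3 * M) ^+ k.
Proof.
elim: k => [|k IHk] fB x; first by rewrite expr0 mulr1.
rewrite iterS exprSr mulrA; apply: norm_shift_Lap; exact: IHk.
Qed.

Lemma iter_shift_Lap_ge0 (B : R) f k : (forall y, `|f y| <= B) ->
  (forall y, 0 <= f y) -> forall x, 0 <= iter k shift_Lap f x.
Proof.
elim: k => [|k IHk] fB f0 x //; rewrite iterS.
by apply: (shift_Lap_ge0 (iter_shift_Lap_bounded k fB)) => y; exact: IHk.
Qed.

Lemma iter_LapB (c B C : R) f g k :
  (forall y, `|f y| <= B) -> (forall y, `|g y| <= C) ->
  iter k (Lap b m) (fun y => c * f y - g y) =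
  fun y => c * iter k (Lap b m) f y - iter k (Lap b m) g y.
Proof.
move=> fB gC; elim: k => //= k ->.
exact: (LapB c (iter_Lap_bounded k fB) (iter_Lap_bounded k gC)).
Qed.

Lemma iter_Lap_binomial (B : R) f x k : (forall y, `|f y| <= B) ->
  iter k (Lap b m) f x =
  \sum_(i < k.+1) 'C(k, i)%:R * M ^+ (k - i) * (-1) ^+ i * iter i shift_Lap f x.
Proof.
move=> fB.
rewrite (@binomial_recurrence _ M (fun k j => iter k (Lap b m) (iter j shift_Lap f) x)
  _ k 0%N) /=; first by apply: eq_bigr => i _; rewrite addn0.
move=> {}k j; rewrite -iterS iterSr.
have -> : Lap b m (iter j shift_Lap f) =
    fun y => M * iter j shift_Lap f y - iter j.+1 shift_Lap f y.
  by apply/funext => y; rewrite iterS /shift_Lap; ring.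
have jB := iter_shift_Lap_bounded j fB.
have j1B := iter_shift_Lap_bounded j.+1 fB.
by rewrite (iter_LapB M k jB j1B).
Qed.

(** The exponential series of -tH is the Cauchy product of those of tP and -tM, hence its limit
    factors. The series of e^(tP) f at [x] has nonnegative terms, so it is at least its zeroth term
    [f x]. *)
Lemma Sg_ge (B t : R) f x : 0 <= t -> (forall y, `|f y| <= B) ->
  (forall y, 0 <= f y) -> expR (- (M * t)) * f x <= Sg b m t f x.
Proof.
move=> t0 fB f0.
have M0 := Deg_bound_ge0 x.
have B0 : 0 <= B by exact: le_trans (fB x).
pose u i := t ^+ i * iter i shift_Lap f x / (i`!)%:R.
have u0 i : 0 <= u i.
  by rewrite !mulr_ge0 ?invr_ge0 ?exprn_ge0// (iter_shift_Lap_ge0 _ fB).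
have ub : exp_bounded u.
  exists B, (t * (3 * M)); split=> // [|i]; first by rewrite !mulr_ge0.
  rewrite /exp_coeff /= ger0_norm// mulrA ler_wpM2r ?invr_ge0//.
  rewrite exprMn mulrCA ler_wpM2l ?exprn_ge0//.
  exact: le_trans (ler_norm _) (iter_shift_Lap_bounded i fB x).
rewrite /Sg.
have -> : (fun k => (- t) ^+ k / (k`!)%:R * iter k (Lap b m) f x) =
    cauchy_prod u (exp_coeff (- (M * t))).
  apply/funext => k; rewrite /cauchy_prod (iter_Lap_binomial x k fB) mulr_sumr.
  apply: eq_bigr => i _.
  have ik : (i <= k)%N by rewrite -ltnS.
  have fn j : (j`!)%:R != 0 :> R by rewrite pnatr_eq0 -lt0n fact_gt0.
  rewrite /u /exp_coeff /= -{1}(subnK ik) exprD -mulNr exprMn.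
  have cn : 'C(k, i)%:R != 0 :> R by rewrite pnatr_eq0 -lt0n bin_gt0.
  rewrite -(bin_fact ik) !natrM.
  rewrite (_ : (- t) ^+ i = (-1) ^+ i * t ^+ i); last by rewrite -exprMn mulN1r.
  rewrite (_ : (- t) ^+ (k - i) = (-1) ^+ (k - i) * t ^+ (k - i)); last first.
    by rewrite -exprMn mulN1r.
  rewrite (_ : (- M) ^+ (k - i) = (-1) ^+ (k - i) * M ^+ (k - i)); last first.
    by rewrite -exprMn mulN1r.
  (* The left side carries (-1)^i twice, once from (-t)^i and once from the binomial expansion;
     [field] does not cancel the pair, so it is inserted on the right. *)
  have ss : (-1) ^+ i * (-1) ^+ i = 1 :> R by rewrite -expr2 sqrr_sign.
  rewrite -[RHS]mul1r -[X in _ = X * _]ss.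
  by field; rewrite !fn cn.
rewrite (cvg_lim _ (@cvg_cauchy_prod_exp _ _ (- (M * t)) ub))// mulrC.
rewrite ler_wpM2r ?expR_ge0//.
have -> : f x = series u 1%N.
  by rewrite /series /= big_nat1 /u fact0 expr0 mul1r divr1.
apply: nondecreasing_cvgn_le; last exact: exp_bounded_cvg.
by apply: nondecreasing_series => i _ _.
Qed.

End SemigroupLowerBound.

(** * The weighted square norm and its coordinates *)

Section WeightedL2Norm.
Variables (R : realType) (X : countType) (m : X -> R).
Hypothesis m_gt0 : forall x, 0 < m x.
Implicit Types (f : X -> R) (x y : X).

Definition l2norm f : R := Num.sqrt (fine (sqnorm m [set: X] f)).

Lemma sqnorm_ge0 (A : set X) f : (0 <= sqnorm m A f)%E.
Proof. by apply: esum_ge0 => x _; rewrite lee_fin mulr_ge0 ?sqr_ge0// ltW. Qed.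

Lemma sqnormE f : in_l2 m f -> sqnorm m [set: X] f = (l2norm f ^+ 2)%:E.
Proof.
move=> fl2; rewrite sqr_sqrtr ?fine_ge0 ?sqnorm_ge0// fineK//.
by rewrite ge0_fin_numE// sqnorm_ge0.
Qed.

Lemma norm_le_sqnorm (C : R) f x : 0 <= C ->
  (sqnorm m [set: X] f <= (C ^+ 2)%:E)%E -> `|f x| * Num.sqrt (m x) <= C.
Proof.
move=> C0 fC.
have : ((f x ^+ 2 * m x)%:E <= (C ^+ 2)%:E)%E.
  apply: le_trans fC; apply: (@esum_ge1 _ _ _ (fun x => (f x ^+ 2 * m x)%:E)) => // y.
  by rewrite lee_fin mulr_ge0 ?sqr_ge0// ltW.
rewrite lee_fin -[X in _ * X](sqr_sqrtr (ltW (m_gt0 x))) -[f x ^+ 2]real_normK ?num_real//.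
by rewrite -exprMn ler_pXn2r// nnegrE mulr_ge0// sqrtr_ge0.
Qed.

Lemma sqnorm_ext0 (D : set X) (v : X -> R) : sqnorm m [set: X] (ext0 D v) = sqnorm m D v.
Proof.
rewrite /sqnorm [RHS]esum_mkcond; apply: eq_esum => x _; rewrite /ext0.
by case: asboolP => Dx; [rewrite mem_set|rewrite memNset// expr0n mul0r].
Qed.

Lemma sqnorm_point (c : R) y :
  sqnorm m [set: X] (fun z => if z == y then c else 0) = (c ^+ 2 * m y)%:E.
Proof.
rewrite /sqnorm -(@esum_set1 _ _ y (fun z => (c ^+ 2 * m z)%:E)).
  rewrite [RHS]esum_mkcond; apply: eq_esum => z _.
  by rewrite in_set1; case: eqP => [->|_]; rewrite // expr0n mul0r.
by rewrite lee_fin mulr_ge0 ?sqr_ge0// ltW.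
Qed.

End WeightedL2Norm.

(** * Operator norm of the Laplacian and finite propagation *)

Section L2Bounds.
Variables (R : realType) (X : countType) (b : X -> X -> R) (m : X -> R).
Hypothesis graph_bm : weighted_graph b m.
Variable M : R.
Hypothesis DegM : forall x, Deg b m x <= M.
Hypothesis M_gt0 : 0 < M.
Implicit Types (f g : X -> R) (x y : X).

Let m_gt0 x : 0 < m x. Proof. by case: graph_bm. Qed.
Let b_ge0 x y : 0 <= b x y. Proof. by case: graph_bm. Qed.
Let b_sym x y : b x y = b y x. Proof. by case: graph_bm. Qed.
Let bsq_ge0 x y (a : R) : 0 <= 2 * b x y * a ^+ 2.
Proof. by apply: mulr_ge0; [exact: mulr_ge0|exact: sqr_ge0]. Qed.

(** Cauchy-Schwarz with weights b(x,y), whose total is at most M m(x), followed by (a - b)^2 <= 2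
    (a^2 + b^2). *)
Lemma Lap_sq_le f x : (((Lap b m f x) ^+ 2 * m x)%:E <=
  M%:E * \esum_(y in [set: X]) (2 * b x y * (f x ^+ 2 + f y ^+ 2))%:E)%E.
Proof.
pose q y := 2 * b x y * (f x ^+ 2 + f y ^+ 2).
have q0 y : 0 <= q y by rewrite !mulr_ge0// addr_ge0// sqr_ge0.
(* For arbitrary [f] the right side may be infinite, and then the bound is trivial because M > 0. *)
have [qs|] := boolP (\esum_(y in [set: X]) (q y)%:E < +oo)%E; last first.
  rewrite -leNgt leye_eq => /eqP ->; rewrite mulry gtr0_sg// mul1e; exact: leey.
have {}qs : rsummable q.
  by move: qs; rewrite /rsummable; under [X in _ -> is_true (X < _)%E]eq_esum do rewrite ger0_norm//.
rewrite (esum_rsum q0 qs) -EFinM lee_fin.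
have bs := rsummable_edges graph_bm x.
have sq_le y : b x y * (f x - f y) ^+ 2 <= q y.
  by rewrite /q; have := b_ge0 x y; have := sqr_ge0 (f x + f y); nra.
have gs : rsummable (fun y => b x y * (f x - f y)).
  (* Summability follows from a <= 1 + a^2 with a = |f x - f y|. *)
  apply: le_rsummable (rsummableD bs qs) => y.
  rewrite [leRHS]ger0_norm ?addr_ge0// normrM ger0_norm//.
  apply: le_trans (lerD (lexx _) (sq_le y)).
  rewrite -{2}[b x y]mulr1 -mulrDr ler_wpM2l// -real_normK ?num_real//.
  by have := sqr_ge0 (`|f x - f y| - 1); nra.
pose s := xsum (fun y => b x y * (f x - f y)); pose g := rsum (fun y => `|b x y * (f x - f y)|).
have sg : `|s| <= g by exact: ler_norm_xsum.
have g0 : 0 <= g by exact: le_trans sg.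
have ags : rsummable (fun y => `|b x y * (f x - f y)|).
  by apply: le_rsummable gs => y; rewrite normr_id.
(* This is the weighted sum of (|f x - f y| - t)^2 >= 0. The choice t = g / (M m(x)) below turns it
   into Cauchy-Schwarz. *)
have young t : 0 <= t -> 2 * t * g <= t ^+ 2 * rsum (b x) + rsum q.
  move=> t0; rewrite -rsumZ//; last by rewrite mulr_ge0.
  rewrite -rsumZ ?sqr_ge0// -rsumD//; last 2 first.
  - by move=> y; rewrite mulr_ge0 ?sqr_ge0.
  - exact: rsummableZ.
  apply: le_rsum; last by apply: rsummableD => //; exact: rsummableZ.
    by move=> y; rewrite !mulr_ge0.
  move=> y; apply: le_trans (lerD (lexx _) (sq_le y)).
  rewrite normrM (ger0_norm (b_ge0 x y)) -[(_ - _) ^+ 2]real_normK ?num_real//.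
  by have := b_ge0 x y; have := sqr_ge0 (`|f x - f y| - t); nra.
have c0 : 0 < M * m x by rewrite mulr_gt0.
have g2 : g ^+ 2 <= M * m x * rsum q.
  have t0 : 0 <= g / (M * m x) by rewrite divr_ge0// ltW.
  have := young _ t0; have := ler_wpM2l (sqr_ge0 (g / (M * m x))) (rsum_edges_le graph_bm DegM x).
  set c := M * m x; rewrite -/c in c0.
  have -> : (g / c) ^+ 2 * c = g ^+ 2 / c by field; rewrite gt_eqF.
  have -> : 2 * (g / c) * g = 2 * (g ^+ 2 / c) by field; rewrite gt_eqF.
  move=> h1 h2; have h3 : g ^+ 2 / c <= rsum q by lra.
  by move: h3; rewrite ler_pdivrMr// mulrC.
have -> : Lap b m f x ^+ 2 * m x = s ^+ 2 / m x.
  by rewrite /Lap -/s; field; rewrite gt_eqF.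
rewrite ler_pdivrMr// mulrAC; apply: le_trans g2.
by rewrite -[s ^+ 2]real_normK ?num_real// ler_pXn2r ?nnegrE.
Qed.

(** Summing [Lap_sq_le] over [x] gives two double sums, exchanged by Tonelli and the symmetry of
    [b]. Each is at most 2 M times the square norm, and M (2 M + 2 M) = (2 M)^2. *)
Lemma sqnorm_Lap f :
  (sqnorm m [set: X] (Lap b m f) <= ((2 * M) ^+ 2)%:E * sqnorm m [set: X] f)%E.
Proof.
pose F (x y : X) : \bar R := (2 * b x y * f x ^+ 2)%:E.
pose F' (x y : X) : \bar R := (2 * b x y * f y ^+ 2)%:E.
have F'0 x y : (0 <= F' x y)%E by rewrite lee_fin bsq_ge0.
have F0 x y : (0 <= F x y)%E by rewrite lee_fin bsq_ge0.
have sumF : (\esum_(x in [set: X]) \esum_(y in [set: X]) F x y <=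
    (2 * M)%:E * sqnorm m [set: X] f)%E.
  rewrite -ge0_esumZl; last 2 first.
  - by rewrite mulr_ge0// ltW.
  - by move=> x; rewrite lee_fin mulr_ge0 ?sqr_ge0// ltW.
  apply: le_esum => x _; rewrite /F.
  under eq_esum do rewrite mulrAC EFinM.
  rewrite ge0_esumZl; [|by rewrite mulr_ge0// sqr_ge0|by move=> y; rewrite lee_fin].
  rewrite (esum_rsum (b_ge0 x) (rsummable_edges graph_bm x)) -!EFinM lee_fin.
  have := ler_wpM2l (sqr_ge0 (f x)) (rsum_edges_le graph_bm DegM x); lra.
have LapM : (sqnorm m [set: X] (Lap b m f) <= \esum_(x in [set: X])
    (M%:E * \esum_(y in [set: X]) (2 * b x y * (f x ^+ 2 + f y ^+ 2))%:E))%E.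
  by apply: le_esum => x _; exact: Lap_sq_le.
apply: (le_trans LapM).
have q0 x y : (0 <= (2 * b x y * (f x ^+ 2 + f y ^+ 2))%:E)%E.
  by rewrite lee_fin !mulr_ge0// addr_ge0// sqr_ge0.
rewrite ge0_esumZl; [|exact: ltW|by move=> x; exact: esum_ge0].
have -> : ((2 * M) ^+ 2 = M * (2 * M + 2 * M)) by ring.
rewrite (EFinM M) -muleA lee_wpmul2l ?lee_fin ?(ltW M_gt0)//.
have splitE x : (\esum_(y in [set: X]) (2 * b x y * (f x ^+ 2 + f y ^+ 2))%:E =
    \esum_(y in [set: X]) F x y + \esum_(y in [set: X]) F' x y)%E.
  by rewrite -esumD//; apply: eq_esum => y _; rewrite mulrDr EFinD.
under eq_esum do rewrite splitE.
rewrite esumD; [|by move=> x _; exact: esum_ge0..].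
rewrite EFinD ge0_muleDl ?lee_fin ?mulr_ge0 ?(ltW M_gt0)//.
apply: leeD; first exact: sumF.
rewrite esum_swap//; apply: le_trans sumF.
by apply: le_esum => x _; apply: le_esum => y _; rewrite /F' b_sym.
Qed.

Lemma sqnorm_iter_Lap f k : (sqnorm m [set: X] (iter k (Lap b m) f) <=
  (((2 * M) ^+ k) ^+ 2)%:E * sqnorm m [set: X] f)%E.
Proof.
elim: k => [|k IHk]; first by rewrite !expr0 expr1n mul1e.
rewrite iterS; apply: le_trans (sqnorm_Lap _) _.
have -> : ((2 * M) ^+ k.+1) ^+ 2 = (2 * M) ^+ 2 * ((2 * M) ^+ k) ^+ 2.
  by rewrite [_ ^+ k.+1]exprS [LHS]exprMn.
by rewrite (EFinM ((2 * M) ^+ 2)) -muleA lee_wpmul2l// lee_fin sqr_ge0.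
Qed.

(** Finite propagation: one application of H looks one edge further, so k applications at distance
    at most j from [y] see only vertices at distance at most j + k. *)
Lemma iter_Lap_vanish f y n : (forall z, dcomb_le b z y n -> f z = 0) ->
  forall k j z, (j + k <= n)%N -> dcomb_le b z y j -> iter k (Lap b m) f z = 0.
Proof.
move=> f0; elim=> [|k IHk] j z jkn [i [ij zy]].
  by apply: f0; exists i; split=> //; rewrite (leq_trans ij)// (leq_trans _ jkn)// addn0.
rewrite iterS /Lap; set h := iter k _ f.
have -> : (fun w => b z w * (h z - h w)) = fun=> 0.
  apply/funext => w; have [bzw|] := ltP 0 (b z w); last first.
    move=> b0; have -> : b z w = 0 by apply/eqP; rewrite eq_le b0 b_ge0.
    by rewrite mul0r.
  have -> : h z = 0.
    apply: (IHk j); first by rewrite (leq_trans _ jkn)// leq_add2l.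
    by exists i.
  suff -> : h w = 0 by rewrite subr0 mulr0.
  apply: (IHk j.+1); first by rewrite addSnnS.
  case: zy => p [p0 pi pb]; exists i.+1; split; first by rewrite ltnS.
  (* The neighbour [w] is put in front of the path from [z] to [y]. *)
  exists (fun l => if l is l'.+1 then p l' else w); split=> //.
  case=> [_|l li]; last exact: pb.
  by rewrite p0 b_sym.
by rewrite xsum0 mulr0.
Qed.

(** Terms 0 to n vanish by propagation, so the tail starts at n + 1; the others are controlled by
    the norm of H^k. Replacing t by T makes the bound uniform in time. *)
Lemma norm_Sg_far f y n t T : in_l2 m f -> 0 <= t <= T ->
  (forall z, dcomb_le b z y n -> f z = 0) ->
  `|Sg b m t f y| * Num.sqrt (m y) <= l2norm m f * exp_tail (2 * M * T) n.+1.
Proof.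
move=> fl2 /andP[t0 tT] f0.
have T0 := le_trans t0 tT.
have N0 : 0 <= l2norm m f by exact: sqrtr_ge0.
have s0 : 0 < Num.sqrt (m y) by rewrite sqrtr_gt0.
have A0 : 0 <= 2 * M * T by rewrite !mulr_ge0// ltW.
rewrite -ler_pdivlMr// mulrAC; apply: norm_lim_series_tail => //.
- by rewrite divr_ge0// ltW.
- move=> k; rewrite normrM normrM normrX normrN (ger0_norm t0) normfV normr_nat.
  have it : `|iter k (Lap b m) f y| * Num.sqrt (m y) <= (2 * M) ^+ k * l2norm m f.
    apply: norm_le_sqnorm => //; first by rewrite mulr_ge0// exprn_ge0// mulr_ge0// ltW.
    by rewrite [_ ^+ 2]exprMn EFinM -sqnormE//; exact: sqnorm_iter_Lap.
  move: it; rewrite -ler_pdivlMr// => it.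
  apply: le_trans (ler_wpM2l _ it) _; first by rewrite divr_ge0// exprn_ge0.
  rewrite /exp_coeff /= (exprMn k (2 * M) T).
  have -> : t ^+ k / (k`!)%:R * ((2 * M) ^+ k * l2norm m f / Num.sqrt (m y)) =
      (l2norm m f / Num.sqrt (m y) * (2 * M) ^+ k / (k`!)%:R) * t ^+ k by ring.
  have -> : l2norm m f / Num.sqrt (m y) * ((2 * M) ^+ k * T ^+ k / (k`!)%:R) =
      (l2norm m f / Num.sqrt (m y) * (2 * M) ^+ k / (k`!)%:R) * T ^+ k by ring.
  apply: ler_wpM2l; last by rewrite lerXn2r ?nnegrE.
  by rewrite !divr_ge0 ?mulr_ge0 ?exprn_ge0 ?mulr_ge0 ?divr_ge0// ltW.
- move=> k; rewrite ltnS => kn.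
  rewrite (iter_Lap_vanish f0 (j := 0%N)) ?mulr0 ?add0n//.
  by exists 0%N; split=> //; exists (fun=> y).
Qed.

End L2Bounds.

(** * Measurability of countable sums and bounds on integrals *)

Section Integrals.
Local Open Scope ereal_scope.
Context {d : measure_display} {S : measurableType d} {R : realType}.

(** The encoding [pickle] turns the sum into a series over the naturals; numbers that encode no
    element of [I] contribute 0. *)
Lemma measurable_fun_esum (X : countType) (A : set S) (I : set X)
    (h : X -> S -> \bar R) :
  (forall x s, 0 <= h x s) -> (forall x, I x -> measurable_fun A (h x)) ->
  measurable_fun A (fun s => \esum_(x in I) h x s).
Proof.
move=> h0 mh.
pose a n s := if pickle_inv n is Some x then if x \in I then h x s else 0 else 0.
have a0 n s : 0 <= a n s by rewrite /a; case: pickle_inv => // x; case: ifP.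
rewrite [X in measurable_fun _ X](_ : _ =
    fun s => \sum_(0 <= n <oo | n \in xpredT) a n s).
  apply: ge0_emeasurable_sum => // n _; rewrite /a.
  case: pickle_inv => [x|]; last exact: measurable_cst.
  by have [/set_mem Ix|_] := boolP (x \in I); [exact: mh|exact: measurable_cst].
apply/funext => s; rewrite esum_mkcond.
rewrite (eq_eseriesl (Q := xpredT))// nneseries_esumT//.
transitivity (\esum_(n in pickle @` [set: X]) a n s).
  rewrite esum_image; first by apply: eq_esum => x _; rewrite /a pickleK_inv.
  by move=> x y _ _; exact: (pcan_inj pickleK).
rewrite esum_mkcond; apply: eq_esum => n _; case: ifPn => // /negP nX.
rewrite /a; case E : (pickle_inv n) => [x|//]; case: nX; apply/mem_set.
by exists x => //; have := @pickle_invK X n; rewrite E.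
Qed.

Variable mu : {measure set S -> \bar R}.

(* Only the majorant has to be measurable: the integral of a nonnegative
   function is a supremum over the simple functions below it. *)
Lemma ge0_le_integral_sup (A : set S) (f g : S -> \bar R) :
  (forall s, A s -> 0 <= f s) -> (forall s, A s -> f s <= g s) ->
  \int[mu]_(s in A) f s <= \int[mu]_(s in A) g s.
Proof.
move=> f0 fg; have g0 s : A s -> 0 <= g s by move=> As; rewrite (le_trans (f0 s As)) ?fg.
rewrite !ge0_integralE//; apply: le_ereal_sup => _ [h hf <-]; exists h => // s.
apply: le_trans (hf s) _; rewrite /patch; case: ifP => // /set_mem; exact: fg.
Qed.

(** The integrals of the positive and negative parts both lie in [0, C], hence so does the absolute
    value of their difference. The control integral is thus bounded through a measurable majorant
    alone. *)
Lemma norm_fine_integral_le (A : set S) (f : S -> R) (g : S -> \bar R) (C : R) :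
  (forall s, A s -> `|f s|%:E <= g s) -> \int[mu]_(s in A) g s <= C%:E ->
  (`|fine (\int[mu]_(s in A) (f s)%:E)| <= C)%R.
Proof.
move=> fg gC; rewrite integralE.
have posg : \int[mu]_(s in A) (fun s => (f s)%:E)^\+ s <= C%:E.
  apply: le_trans gC; apply: ge0_le_integral_sup => s As //.
  apply: le_trans (fg s As); rewrite funeposE ge_max lee_fin ler_norm.
  by rewrite lee_fin normr_ge0.
have negg : \int[mu]_(s in A) (fun s => (f s)%:E)^\- s <= C%:E.
  apply: le_trans gC; apply: ge0_le_integral_sup => s As //.
  apply: le_trans (fg s As); rewrite funenegE ge_max lee_fin -normrN ler_norm.
  by rewrite lee_fin normr_ge0.
have pos0 : 0 <= \int[mu]_(s in A) (fun s => (f s)%:E)^\+ s by exact: integral_ge0.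
have neg0 : 0 <= \int[mu]_(s in A) (fun s => (f s)%:E)^\- s by exact: integral_ge0.
move: posg negg pos0 neg0; case: (integral _ _ _) => [p| |]//.
case: (integral _ _ _) => [q| |]//; rewrite !lee_fin /= => ? ? ? ?.
by rewrite ler_norml; apply/andP; split; lra.
Qed.

End Integrals.

(** * Influence of the control at a vertex far from [D] *)

Section Control.
Variables (R : realType) (X : countType) (b : X -> X -> R) (m : X -> R).
Hypothesis graph_bm : weighted_graph b m.
Variable M : R.
Hypothesis DegM : forall x, Deg b m x <= M.
Hypothesis M_gt0 : 0 < M.
Variables (D : set X) (T r : R).
Hypothesis T_gt0 : 0 < T.
Hypothesis r_ge1 : 1 <= r.

Let m_gt0 x : 0 < m x. Proof. by case: graph_bm. Qed.

Lemma measurable_control_norm (u : R -> X -> R) :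
  (forall x, D x -> measurable_fun (I0t T) (fun s => u s x)) ->
  measurable_fun (I0t T) (fun s => (Num.sqrt (fine (sqnorm m D (u s)))) `^ r).
Proof.
move=> mu; apply: (measurableT_comp (measurable_powR r)).
apply: (measurableT_comp (continuous_measurable_fun (@sqrt_continuous R))).
apply: (measurableT_comp (@fine_measurable R setT measurableT)).
apply: measurable_fun_esum.
  by move=> x s; rewrite lee_fin mulr_ge0 ?sqr_ge0// ltW.
move=> x Dx; apply/measurable_EFinP; apply: measurable_funM => //.
by apply: measurable_funX; exact: mu.
Qed.

(** [norm_Sg_far] bounds the integrand by the tail times the norm N of u(s). In place of Hölder's
    inequality, N <= 1 + N^r for r >= 1 makes the integral at most T + K^r. *)
Lemma control_term_le (K : R) (u : R -> X -> R) y n :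
  Lr_control m D T r K u -> (forall z, D z -> ~ dcomb_le b z y n) ->
  `|fine (\int[lebesgue_measure]_(s in I0t T) (Sg b m (T - s) (ext0 D (u s)) y)%:E)%E|
  <= (Num.sqrt (m y))^-1 * exp_tail (2 * M * T) n.+1 * (T + K `^ r).
Proof.
move=> [mu ufin intfin intK] far.
pose N s := Num.sqrt (fine (sqnorm m D (u s))).
set eps := exp_tail _ _.
have s0 : 0 < Num.sqrt (m y) by rewrite sqrtr_gt0.
have r_gt0 : 0 < r by exact: lt_le_trans r_ge1.
have eps0 : 0 <= eps by rewrite exp_tail_ge0// !mulr_ge0// ltW.
have c0 : 0 <= (Num.sqrt (m y))^-1 * eps by rewrite mulr_ge0// invr_ge0 ltW.
have mN := measurable_control_norm mu.
have mI : measurable (I0t T) by exact: measurable_itv.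
pose F s := Sg b m (T - s) (ext0 D (u s)) y.
pose G s : \bar R := (((Num.sqrt (m y))^-1 * eps)%:E * (1%:E + (N s `^ r)%:E))%E.
apply: (@norm_fine_integral_le _ _ R lebesgue_measure (I0t T) F G); rewrite /F /G.
  move=> s sT; have /andP[s_ge0 s_leT] : 0 <= s <= T by move: sT; rewrite /I0t/= in_itv.
  rewrite -EFinD -EFinM lee_fin.
  have far0 z : dcomb_le b z y n -> ext0 D (u s) z = 0.
    by rewrite /ext0; case: asboolP => // Dz /(far _ Dz).
  have ul2 : in_l2 m (ext0 D (u s)) by rewrite /in_l2 sqnorm_ext0 ufin.
  have tT : 0 <= T - s <= T by rewrite subr_ge0 s_leT lerBlDr lerDl.
  have := norm_Sg_far graph_bm DegM M_gt0 ul2 tT far0.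
  rewrite /l2norm sqnorm_ext0 -/(N s) -/eps -ler_pdivlMr// => /le_trans; apply.
  rewrite [leLHS](_ : _ = (Num.sqrt (m y))^-1 * eps * N s); last by ring.
  apply: ler_wpM2l => //.
  have N0 : 0 <= N s by exact: sqrtr_ge0.
  have [N1|N1] := leP (N s) 1; first by have := powR_ge0 (N s) r; lra.
  have : N s `^ 1 <= N s `^ r by rewrite ler_powR// ltW.
  by rewrite powRr1//; lra.
have N_ge0 s : I0t T s -> (0 <= (N s `^ r)%:E)%E by move=> _; rewrite lee_fin powR_ge0.
rewrite ge0_integralZl_EFin//; last 2 first.
- by move=> s Is; rewrite adde_ge0// N_ge0.
- by apply: emeasurable_funD; [exact: measurable_cst|exact/measurable_EFinP].
rewrite ge0_integralD//; last first.
  exact/measurable_EFinP.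
have itvT : lebesgue_measure (I0t T) = T%:E.
  by rewrite /I0t lebesgue_measure_itv /= lte_fin T_gt0 oppr0 adde0.
rewrite integral_cst// mul1e [X in (_ * (X + _))%E](itvT : _ = T%:E).
set J := (integral _ _ _).
have J0 : (0 <= J)%E by exact: integral_ge0.
have Jfin : J \is a fin_num by rewrite ge0_fin_numE.
rewrite -[J]fineK// -EFinD -EFinM lee_fin ler_wpM2l// lerD2l.
have j0 : 0 <= fine J by rewrite fine_ge0.
(* The hypothesis bounds the r-th root of the integral, so the integral is written as its r-th
   power. *)
have -> : fine J = (fine J `^ r^-1) `^ r.
  by rewrite -powRrM mulVf ?gt_eqF// powRr1.
have K0 : 0 <= K by apply: le_trans intK; exact: powR_ge0.
by apply: ge0_ler_powR; rewrite ?nnegrE ?powR_ge0// ltW.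
Qed.

End Control.

(** * The contradiction at a distant vertex *)

Theorem mainTheorem5 (R : realType) (X : countType) (b : X -> X -> R) (m : X -> R)
  (D : set X) (T r K alpha : R) :
  weighted_graph b m ->
  connected_graph b -> bounded_deg b m -> bounded_meas m ->
  0 < T -> 1 <= r -> 0 <= K ->
  0 <= alpha -> alpha < expR (- (Dmax b m * T)) ->
  controllable b m D alpha T r K ->
  dcomb_rel_dense b D.
Proof.
move=> gbm _ [M0 DegM0] _ T0 r1 K0 alpha0 alpha_lt ctrl.
have DegDmax x : Deg b m x <= Dmax b m.
  by apply: ub_le_sup; [exists M0 => _ [z _ <-]|exists x].
(* [Dmax] is 0 on a single vertex while the $\ell_2$ bounds take a positive constant. The lower
   bound on the semigroup keeps [Dmax] itself, so its exponent stays sharp. *)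
pose M := Num.max 1 (Dmax b m).
have M_gt0 : 0 < M by rewrite lt_max ltr01.
have DegM x : Deg b m x <= M by rewrite le_max DegDmax orbT.
(* The distance n makes the whole influence of the control smaller than the gap left by [alpha]. *)
have [n eps_lt] : exists n, exp_tail (2 * M * T) n.+1 * (T + K `^ r) <
    expR (- (Dmax b m * T)) - alpha.
  have tail0 : exp_tail (2 * M * T) n.+1 * (T + K `^ r) @[n --> \oo] --> (0 : R).
    rewrite -(mul0r (T + K `^ r)); apply: cvgMl.
    by have := @cvg_exp_tail R (2 * M * T); rewrite -cvg_shiftS.
  have gap : 0 < expR (- (Dmax b m * T)) - alpha by rewrite subr_gt0.
  have /cvgr0Pnorm_lt/(_ _ gap)[n _ /(_ n (leqnn n))] := tail0.
  by move=> h; exists n; exact: le_lt_trans (ler_norm _) h.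
apply: contrapT => notdense.
have [y far] : exists y, forall z, D z -> ~ dcomb_le b z y n.
  (* The radius is n + 1 because it must be positive and n may be 0. *)
  apply: contrapT => nofar; apply: notdense; exists n.+1%:R; split; first by rewrite ltr0n.
  move=> y; apply: contrapT => yfar; apply: nofar; exists y => z Dz zy.
  by apply: yfar; exists z; split=> //; exists n; split=> //; rewrite ler_nat.
have m_gt0 : forall x, 0 < m x by case: gbm.
have my0 := m_gt0 y.
have s0 : 0 < Num.sqrt (m y) by rewrite sqrtr_gt0.
pose c := (Num.sqrt (m y))^-1.
have c0 : 0 < c by rewrite invr_gt0.
have cs : c * Num.sqrt (m y) = 1 by rewrite mulVf ?gt_eqF.
pose f0 z := if z == y then c else 0.
have f0_norm : sqnorm m [set: X] f0 = 1%:E.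
  rewrite (sqnorm_point m_gt0); congr EFin.
  by rewrite -[X in _ * X](sqr_sqrtr (ltW my0)) -exprMn cs expr1n.
have [|u [uK]] := ctrl f0; first by rewrite /in_l2 f0_norm ltry.
rewrite f0_norm /= sqrtr1 !mulr1 in uK * => fT.
have := norm_le_sqnorm m_gt0 y alpha0 fT; rewrite /mild_sol => fTy.
have := control_term_le gbm DegM M_gt0 T0 r1 uK far.
set I := fine _ in fTy *; rewrite -/c => I_le.
have Sg_low : expR (- (Dmax b m * T)) * c <= Sg b m T f0 y.
  have f0y : f0 y = c by rewrite /f0 eqxx.
  rewrite -{1}f0y; apply: (Sg_ge gbm DegDmax (B := c)); first exact: ltW.
    by move=> z; rewrite /f0; case: ifP => _; rewrite ?normr0 ?ger0_norm// ltW.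
  by move=> z; rewrite /f0; case: ifP => _ //; exact: ltW.
have : alpha < `|Sg b m T f0 y + I| * Num.sqrt (m y); last by rewrite ltNge fTy.
(* The factor sqrt(m y) cancels [c], so the comparison with [alpha] no longer depends on [y], and n
   could be fixed before [y]. *)
apply: (@lt_le_trans _ _ ((expR (- (Dmax b m * T)) * c -
    c * exp_tail (2 * M * T) n.+1 * (T + K `^ r)) * Num.sqrt (m y))).
  rewrite [ltRHS](_ : _ = (expR (- (Dmax b m * T)) -
    exp_tail (2 * M * T) n.+1 * (T + K `^ r)) * (c * Num.sqrt (m y))); last by ring.
  by rewrite cs mulr1; lra.
apply: ler_wpM2r; first exact: ltW.
apply: le_trans (ler_norm _); apply: lerD => //.
by move: I_le; rewrite ler_norml => /andP[+ _]; rewrite -/c; lra.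
Qed.
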